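(* Let $\mathcal{B}$ be an M-basis in $\mathbb{X}$ and let $\tau\in(0,1]$. For every $m\in\mathbb{N}\cup\{0\}$, $$\frac{\nu'_{m,\tau,\ell}}{\tau}\ \le\ \max_{0\le k\le m}\widehat{\mathbf L}^{re}_{k,\tau}.$$
   Context: Setting. $(\mathbb{X},\|\cdot\|)$ is an infinite-dimensional Banach space over $\mathbb{F}=\mathbb{R}$ or $\mathbb{C}$ with dual $(\mathbb{X}^*,\|\cdot\|_* )$. A (semi-normalized Markushevich) M-basis is a sequence $\mathcal{B}=(e_n)_{n=1}^\infty$ in $\mathbb{X}$ such that: (1) there is a unique collection $(e_n^* )_{n=1}^\infty\subset\mathbb{X}^*$ with $e_i^*(e_j)=\delta_{i,j}$; (2) $0<\inf_n\{\|e_n\|,\|e_n^*\|_*\}\le\sup_n\{\|e_n\|,\|e_n^*\|_*\}<\infty$; (3) $\mathbb{X}=\overline{\mathrm{span}\{e_n:n\in\mathbb{N}\}}$; (4) $\mathbb{X}^*=\overline{\mathrm{span}\{e_n^*:n\in\mathbb{N}\}}^{w^*}$. Notation. $\mathrm{supp}(x)=\{n:e_n^*(x)\ne0\}$, $\|x\|_\infty=\sup_n|e_n^*(x)|$, $P_A(x)=\sum_{n\in A}e_n^*(x)e_n$ for finite $A\subset\mathbb{N}$, and $S_n(x)=\sum_{i=1}^ne_i^*(x)e_i$ ($S_0=0$). A sign is a sequence $\varepsilon=(\varepsilon_n)\subset\mathbb{F}$ with $|\varepsilon_n|=1$, and $1_{\varepsilon A}=\sum_{n\in A}\varepsilon_ne_n$.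 For sets of positive integers, $B<D$ means every element of $B$ is smaller than every element of $D$ (vacuous if one is empty), and $B\le m$ means every element of $B$ is at most $m$. Weak greedy sets. A finite $\Lambda\subset\mathbb{N}$ is a $\tau$-weak greedy set of $x$ if $\min_{n\in\Lambda}|e_n^*(x)|\ge\tau\max_{n\notin\Lambda}|e_n^*(x)|$ (the empty set is always allowed). $\mathcal{G}(x,m,\tau)$ is the collection of all $\tau$-weak greedy sets of $x$ of cardinality $m$, and $\gamma_{m,\tau}(x)=\sup\{\|x-P_\Lambda(x)\|:\Lambda\in\mathcal{G}(x,m,\tau)\}$. Strong residual Lebesgue parameter. $\widehat\sigma_m(x)=\inf_{0\le n\le m}\|x-S_n(x)\|$, and $\widehat{\mathbf L}^{re}_{m,\tau}$ is the smallest constant such that $\gamma_{m,\tau}(x)\le\widehat{\mathbf L}^{re}_{m,\tau}\widehat\sigma_m(x)$ for all $x\in\mathbb{X}$. Left constant. $\nu'_{m,\tau,\ell}$ is the supremum of $\dfrac{\|\tau x+1_{\delta B}\|}{\|x+1_{\varepsilon A}\|}$ (nonzero denominators only) over all signs $(\varepsilon),(\delta)$, all $x\in\mathbb{X}$ with $\|x\|_\infty\le1/\tau$, and all finite $A,B\subset\mathbb{N}$ such that $|B|\le|A|\le m$, $A\cap\mathrm{supp}(x)=\emptyset$, $B<\mathrm{supp}(x)\cup A$, and $B\le m$. *)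

(* Defs.v *)
From HB Require Import structures.
From mathcomp Require Import all_boot all_order all_algebra finmap.
From mathcomp Require Import boolp classical_sets functions reals ereal.
From mathcomp Require Import topology function_spaces normedtype complex.

Set Implicit Arguments.
Unset Strict Implicit.
Unset Printing Implicit Defensive.

Import Order.TTheory GRing.Theory Num.Theory.
Import numFieldNormedType.Exports.

Local Open Scope classical_set_scope.
Local Open Scope ring_scope.

(* Sequences are indexed from 0: [e n] stands for the basis vector e_{n+1} and
   the element n of a set of indices stands for the positive integer n + 1. *)

Variant scalar_kind := RealScalars | ComplexScalars.

Definition scalars (R : realType) (F : scalar_kind) : numFieldType :=
  match F with
  | RealScalars => R : numFieldType
  | ComplexScalars => (R[i])%C : numFieldType
  end.

Definition of_real (R : realType) (F : scalar_kind) : R -> scalars R F :=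
  match F return R -> scalars R F with
  | RealScalars => fun r => r
  | ComplexScalars => fun r => real_complex R r
  end.

Definition to_real (R : realType) (F : scalar_kind) : scalars R F -> R :=
  match F return scalars R F -> R with
  | RealScalars => fun r => r
  | ComplexScalars => fun z => complex.Re z
  end.

(* The norm of a normed module over K is K-valued in the library; when K is the
   field of complex numbers it is a nonnegative real element of K. *)
Definition rnorm (R : realType) (F : scalar_kind)
    (V : normedModType (scalars R F)) (x : V) : R :=
  to_real `|x|.

Section Span.
Context {K : numFieldType} {V : lmodType K}.

Definition span_seq (v : nat -> V) : set V :=
  [set y | exists n (a : nat -> K), y = \sum_(i < n) a i *: v i].

Definition infinite_dimensional : Prop :=
  ~ exists n (v : 'I_n -> V), forall y, exists a : 'I_n -> K,
    y = \sum_i a i *: v i.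

End Span.

Arguments infinite_dimensional {K} V.

Section Basis.
Context {R : realType} {F : scalar_kind}.
Local Notation K := (scalars R F).
Context {X : completeNormedModType K}.
Local Notation functional := {linear X -> K^o}.

Definition dual_norm (f : functional) : \bar R :=
  ereal_sup [set (rnorm (f x))%:E | x in [set x : X | rnorm x <= 1]].

Definition biorthogonal (e : nat -> X) (e' : nat -> functional) : Prop :=
  (forall n, continuous (e' n)) /\
  (forall i j, e' i (e j) = (i == j)%:R).

Definition basis_norms (e : nat -> X) (e' : nat -> functional) :
    set (\bar R) :=
  range (fun n => (rnorm (e n))%:E) `|` range (fun n => dual_norm (e' n)).

(* The weak-star topology of the dual is induced by the topology of pointwise convergence
   [{ptws X -> K}], in which the closure is taken. *)
Record Mbasis (e : nat -> X) (e' : nat -> functional) : Prop := {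
  Mbasis_biorthogonal : biorthogonal e e' ;
  Mbasis_unique : forall f : nat -> functional,
    biorthogonal e f -> forall n, f n =1 e' n ;
  Mbasis_inf : (0 < ereal_inf (basis_norms e e'))%E ;
  Mbasis_sup : (ereal_sup (basis_norms e e') < +oo)%E ;
  Mbasis_total : closure (span_seq e) = [set: X] ;
  Mbasis_weak_star : forall f : functional, continuous f ->
    closure (span_seq (fun n => e' n : X -> K^o) : set {ptws X -> K^o}) f }.

Definition is_sign (eps : nat -> K) : Prop :=
  forall n, rnorm (eps n : K^o) = 1.

Definition set_lt (B D : set nat) : Prop :=
  forall b d, B b -> D d -> (b < d)%N.

Section Constants.
Variables (e : nat -> X) (e' : nat -> functional).

Definition supp (x : X) : set nat := [set n | e' n x != 0].

Definition norm_infty (x : X) : \bar R :=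
  ereal_sup (range (fun n => (rnorm (e' n x))%:E)).

Definition proj (A : {fset nat}) (x : X) : X := \sum_(n <- A) e' n x *: e n.

Definition partial_sum (n : nat) (x : X) : X := \sum_(i < n) e' i x *: e i.

Definition signed_sum (eps : nat -> K) (A : {fset nat}) : X :=
  \sum_(n <- A) eps n *: e n.

Definition greedy_sets (x : X) (m : nat) (tau : R) : set {fset nat} :=
  [set L : {fset nat} | #|` L| = m /\
    forall n k, n \in L -> k \notin L ->
      tau * rnorm (e' k x) <= rnorm (e' n x)].

Definition gamma (m : nat) (tau : R) (x : X) : \bar R :=
  ereal_sup [set (rnorm (x - proj L x))%:E | L in greedy_sets x m tau].

Definition sigma_hat (m : nat) (x : X) : \bar R :=
  ereal_inf [set (rnorm (x - partial_sum n x))%:E | n in [set n | (n <= m)%N]].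

Definition Lre_hat (m : nat) (tau : R) : \bar R :=
  ereal_inf [set C%:E | C in
    [set C : R | forall x, (gamma m tau x <= C%:E * sigma_hat m x)%E]].

(* Given the indexing from 0, [b < m] is the condition B <= m. *)
Definition nu_left (m : nat) (tau : R) : \bar R :=
  ereal_sup [set r : \bar R |
    exists (eps delta : nat -> K) (x : X) (A B : {fset nat}),
      [/\ is_sign eps, is_sign delta & (norm_infty x <= (tau^-1)%:E)%E] /\
      [/\ (#|` B| <= #|` A|)%N, (#|` A| <= m)%N,
          [set` A] `&` supp x = set0,
          set_lt [set` B] (supp x `|` [set` A]) &
          forall b, b \in B -> (b < m)%N] /\
      rnorm (x + signed_sum eps A) != 0 /\
      r = (rnorm (of_real F tau *: x + signed_sum delta B) /
           rnorm (x + signed_sum eps A))%:E].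

End Constants.
End Basis.

(* Main.v *)
(** Given an admissible [(eps, delta, x, A, B)], let [n] be the least integer with
    [B] below [n], so that [n <= m] and [A], [supp x] lie at or above [n].
    Complete [A] by [max (0, n - |A|)] elements of [{0, ..., n-1} \ B] to a set [L];
    this is possible because [|B| <= |A|], and gives [n <= |L| <= m].
    For [y = tau (x + 1_{eps A} + 1_{L \ A}) + 1_{delta B}] the set [L] is
    tau-weakly greedy, [y - P_L y = tau x + 1_{delta B}] and
    [y - S_n y = tau (x + 1_{eps A})], so the parameter of index [|L|] bounds the
    quotient. *)
Require Import Defs.
From mathcomp Require Import all_boot all_order all_algebra finmap.
From mathcomp Require Import boolp classical_sets.
From mathcomp Require Import reals ereal normedtype complex.
Import Order.TTheory GRing.Theory Num.Theory.
Import numFieldNormedType.Exports.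
Local Open Scope ring_scope.

Section Scalars.
Context {R : realType} {F : scalar_kind}.
Local Notation K := (scalars R F).

Lemma of_real_ge0 (t : R) : 0 <= t -> 0 <= of_real F t.
Proof. by case: F => //= t0; rewrite lecR. Qed.

Lemma to_real_ge0 (z : K) : 0 <= z -> 0 <= to_real z.
Proof. by case: F z => [|] //= z; rewrite lecE => /andP[]. Qed.

Lemma to_realM_of_real (t : R) (z : K) : to_real (of_real F t * z) = t * to_real z.
Proof. by case: F z => [|] //= [a b] /=; rewrite mul0r subr0. Qed.

(** The order of [R[i]] compares only numbers with equal imaginary parts, so [0 <= z] already makes
    [z] real. *)
Lemma to_real_eq0 (z : K) : 0 <= z -> to_real z = 0 -> z = 0.
Proof.
case: F z => [|] //= [a b]; rewrite lecE /= => /andP[/eqP -> _] ->.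
by [].
Qed.

Lemma to_real0 : to_real (0 : K) = 0.
Proof. by case: F. Qed.

Lemma to_real1 : to_real (1 : K) = 1.
Proof. by case: F. Qed.

Context {X : normedModType K}.

Lemma rnorm_ge0 (x : X) : 0 <= rnorm x.
Proof. exact: to_real_ge0. Qed.

Lemma rnorm0 : rnorm (0 : X) = 0.
Proof. by rewrite /rnorm normr0 to_real0. Qed.

Lemma rnorm_eq0 (x : X) : rnorm x = 0 -> x = 0.
Proof. by move=> /to_real_eq0 => /(_ (normr_ge0 _)) /normr0_eq0. Qed.

Lemma rnormZ (t : R) (x : X) : 0 <= t -> rnorm (of_real F t *: x) = t * rnorm x.
Proof.
by move=> t0; rewrite /rnorm normrZ ger0_norm ?of_real_ge0 // to_realM_of_real.
Qed.

End Scalars.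

Section Sums.
Context {R : realType} {F : scalar_kind}.
Local Notation K := (scalars R F).
Context {X : completeNormedModType K}.
Variables (e : nat -> X) (e' : nat -> {linear X -> K^o}).
Hypothesis ee' : forall i j, e' i (e j) = (i == j)%:R.

Lemma coef_signed_sum eta (L : {fset nat}) i :
  e' i (signed_sum e eta L) = if i \in L then eta i else 0.
Proof.
rewrite /signed_sum linear_sum /=.
under eq_bigr => j _ do rewrite linearZ /= ee'.
case: ifPn => iL.
  rewrite (big_fsetD1 i) //= eqxx [X in X + _]mulr1 big1_seq ?addr0 // => j /=.
  by rewrite !inE eq_sym => /andP[/negPf -> _]; rewrite [LHS]mulr0.
rewrite big1_seq // => j /= jL; case: eqVneq => [ij|_]; last by rewrite [LHS]mulr0.
by rewrite ij jL in iL.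
Qed.

Lemma partial_sumZD n a (u v : X) :
  partial_sum e e' n (a *: u + v) = a *: partial_sum e e' n u + partial_sum e e' n v.
Proof.
rewrite /partial_sum scaler_sumr -big_split; apply: eq_bigr => i _ /=.
by rewrite linearD linearZ /= scalerDl scalerA.
Qed.

Lemma partial_sum_signed_sum n eta (L : {fset nat}) :
  (forall i, i \in L -> (i < n)%N) ->
  partial_sum e e' n (signed_sum e eta L) = signed_sum e eta L.
Proof.
move=> Ln; rewrite /partial_sum.
under eq_bigr => i _ do rewrite coef_signed_sum.
rewrite -(big_mkord xpredT (fun i => (if i \in L then eta i else 0) *: e i)).
rewrite /index_iota subn0 (bigID (mem L)) /= [X in _ + X]big1 ?addr0; last first.
  by move=> i /negPf ->; rewrite scale0r.
rewrite -big_filter /signed_sum (perm_big L) /=.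
  by apply: eq_big_seq => i ->.
apply: uniq_perm => [||i]; rewrite ?filter_uniq ?iota_uniq ?fset_uniq //.
rewrite mem_filter mem_iota /= add0n.
by apply/andP/idP => [[]//|iL]; rewrite Ln.
Qed.

(** The index [k] is existential because the size of [L] depends on [A] and [B]; this is why the
    theorem takes a maximum over [k]. *)
Lemma exists_Lre_vector {tau : R} {m : nat} {eps delta : nat -> K} {x : X}
    {A B : {fset nat}} :
  0 < tau -> tau <= 1 -> is_sign eps -> is_sign delta ->
  (norm_infty e' x <= (tau^-1)%:E)%E ->
  (#|` B| <= #|` A|)%N -> (#|` A| <= m)%N ->
  ([set` A] `&` supp e' x = set0)%classic ->
  set_lt [set` B]%classic (supp e' x `|` [set` A])%classic ->
  (forall b, b \in B -> (b < m)%N) ->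
  exists n k y L, [/\ (n <= k)%N, (k <= m)%N, greedy_sets e' y k tau L,
    y - proj e e' L y = of_real F tau *: x + signed_sum e delta B &
    y - partial_sum e e' n y = of_real F tau *: (x + signed_sum e eps A)].
Proof.
move=> tau0 tau1 heps hdelta hx BA Am Ax BxA Bm.
(* The successor makes [B] fall within the range of [S_n]; an empty [B] gives [n = 0]. *)
pose n := (\max_(b <- B) b.+1)%N.
have Bn b : b \in B -> (b < n)%N.
  by move=> bB; rewrite /n (big_fsetD1 b) //= leq_max leqnn.
have nm : (n <= m)%N by rewrite /n; apply/bigmax_leqP_seq => b bB _; exact: Bm.
(* An index below [n] is dominated by an element of [B], so [BxA] keeps it out of both [A] and
   [supp x]. *)
have ltnB i : (i < n)%N -> exists2 b, b \in B & (i <= b)%N.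
  move=> iltn; apply: contrapT => h; move: iltn; apply/negP; rewrite -leqNgt.
  apply/bigmax_leqP_seq => b bB _; rewrite ltnNge; apply/negP => ib.
  by apply: h; exists b.
have An i : i \in A -> (n <= i)%N.
  move=> iA; rewrite leqNgt; apply/negP => /ltnB[b bB].
  by rewrite leqNgt => /negP; apply; apply: BxA => //; right.
have xn i : (i < n)%N -> e' i x = 0.
  move=> /ltnB[b bB ib]; apply/eqP; apply: contraLR ib => ix.
  by rewrite -ltnNge; apply: BxA => //; left.
have xA i : i \in A -> e' i x = 0.
  move=> iA; apply/eqP/negP => /negP ix.
  by have : (set0 : set nat) i by rewrite -Ax; split.
pose f := [seq i <- iota 0 n | i \notin B].
(* The subtraction is truncated: nothing is added once [A] has [n] elements. *)
pose s := take (n - #|` A|) f.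
have sf i : i \in s -> (i < n)%N && (i \notin B).
  by move=> /mem_take; rewrite mem_filter mem_iota andbC.
have size_s : size s = (n - #|` A|)%N.
  rewrite size_takel //.
  (* As [f] and [B] together cover [{0, ..., n-1}], [f] has at least [n - |B| >= n - |A|]
     elements. *)
  have : (size (iota 0 n) <= size (f ++ B))%N.
    apply: uniq_leq_size (iota_uniq _ _) _ => i iI.
    by rewrite mem_cat mem_filter iI andbT orNb.
  rewrite size_iota size_cat addnC -leq_subLR; apply: leq_trans.
  exact: leq_sub2l.
have us : uniq s by rewrite take_uniq ?filter_uniq ?iota_uniq.
have uAs : uniq (A ++ s).
  rewrite cat_uniq fset_uniq us andbT.
  apply/hasPn => i /sf/andP[ilt _]; apply/negP => /An.
  by rewrite leqNgt ilt.
pose L := seq_fset tt (A ++ s).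
have LE i : (i \in L) = (i \in A) || (i \in s) by rewrite seq_fsetE mem_cat.
(* Any unimodular value would do off [A]; the coefficients of [y] on [L] then have modulus exactly
   [tau]. *)
pose eta i := if i \in A then eps i else 1.
have eta1 i : rnorm (eta i : K^o) = 1.
  by rewrite /eta; case: ifP => // _; rewrite /rnorm normr1 to_real1.
pose S := seq_fset tt s.
have SE i : (i \in S) = (i \in s) by rewrite seq_fsetE.
have etaL : signed_sum e eta L = signed_sum e eps A + signed_sum e eta S.
  rewrite /signed_sum (perm_big (A ++ s)); last first.
    by apply: uniq_perm (fset_uniq L) uAs _ => i; rewrite seq_fsetE.
  rewrite big_cat /=; congr (_ + _); last first.
    apply: perm_big; rewrite perm_sym; apply: uniq_perm (fset_uniq S) us _ => i.
    by rewrite seq_fsetE.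
  by apply: eq_big_seq => i iA; rewrite /eta iA.
have LB i : i \in L -> i \notin B.
  rewrite LE => /orP[/An ni|/sf/andP[]//].
  by apply/negP => /Bn; rewrite ltnNge ni.
have Lx i : i \in L -> e' i x = 0.
  by rewrite LE => /orP[/xA//|/sf/andP[/xn]].
pose y := of_real F tau *: (x + signed_sum e eta L) + signed_sum e delta B.
have yE i : e' i y = of_real F tau * (e' i x + (if i \in L then eta i else 0))
    + (if i \in B then delta i else 0).
  by rewrite /y linearD linearZ /= linearD /= !coef_signed_sum.
have yL i : i \in L -> e' i y = of_real F tau * eta i.
  by move=> iL; rewrite yE iL Lx // (negPf (LB _ iL)) add0r addr0.
exists n, (#|` A| + (n - #|` A|))%N, y, L; split.
- by rewrite -maxnE leq_maxr.
- by rewrite -maxnE geq_max Am nm.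
- split; first by rewrite size_seq_fset undup_id // size_cat size_s.
  (* After cancelling [tau], it remains to bound the coefficients off [L] by 1: on [B] they are
     [delta k], and elsewhere they are [tau] times those of [x], which are at most [1 / tau]. *)
  move=> i k iL kL; rewrite (yL i iL).
  rewrite [leRHS](rnormZ (X := K^o)) ?eta1 ?(ltW tau0) // ler_pM2l //.
  rewrite yE (negPf kL) addr0; case: ifPn => kB.
    have -> : e' k x = 0 by rewrite xn ?Bn.
    by rewrite mulr0 add0r hdelta.
  rewrite addr0 [leLHS](rnormZ (X := K^o)) ?(ltW tau0) // mulrC -ler_pdivlMr // div1r -lee_fin.
  by apply: le_trans hx; apply: ereal_sup_ubound; exists k.
- have -> : proj e e' L y = of_real F tau *: signed_sum e eta L.
    rewrite /proj /signed_sum scaler_sumr; apply: eq_big_seq => i iL.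
    by rewrite yL // scalerA.
  by rewrite /y scalerDr addrAC addrK.
(* Below [n] both [x] and [1_{eps A}] have zero coefficients, while [S] and [B] lie entirely below
   [n], so [S_n] fixes their signed sums. *)
- have -> : partial_sum e e' n y =
      of_real F tau *: signed_sum e eta S + signed_sum e delta B.
    have Sn i : i \in S -> (i < n)%N by rewrite SE => /sf/andP[].
    rewrite -[in RHS](partial_sum_signed_sum n eta S Sn).
    rewrite -[in RHS](partial_sum_signed_sum n delta B Bn).
    rewrite -partial_sumZD; apply: eq_bigr => -[i /= ilt] _; congr (_ *: _).
    rewrite yE linearD linearZ /= !coef_signed_sum xn // add0r LE SE.
    by have /negPf -> : i \notin A by apply: contraTN ilt => /An; rewrite -leqNgt.
  by rewrite /y etaL addrA scalerDr -[X in X - _]addrA addrK.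
Qed.

Lemma gamma_ge {k : nat} {tau : R} {y : X} {L : {fset nat}} :
  greedy_sets e' y k tau L ->
  ((rnorm (y - proj e e' L y))%:E <= gamma e e' k tau y)%E.
Proof. by move=> gL; apply: ereal_sup_ubound; exists L. Qed.

(* The vector [e k] has a weakly greedy set [{1, ..., k}] and every
   [S_n (e k)], [n <= k], vanishes. *)
Lemma Lre_constant_ge0 k (tau C : R) :
  (forall x, (gamma e e' k tau x <= C%:E * sigma_hat e e' k x)%E) -> 0 <= C.
Proof.
move=> /(_ (e k)) gC.
have ek0 : rnorm (e k) != 0.
  apply/eqP => /rnorm_eq0 ek; have := ee' k k.
  by rewrite ek linear0 eqxx => /eqP; rewrite eq_sym oner_eq0.
have ek_gt0 : 0 < rnorm (e k) by rewrite lt_neqAle eq_sym ek0 rnorm_ge0.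
have gL : greedy_sets e' (e k) k tau (seq_fset tt (iota 1 k)).
  split; first by rewrite size_seq_fset undup_id ?iota_uniq // size_iota.
  move=> n j; rewrite !seq_fsetE !mem_iota => /andP[n1 nk] jk.
  (* The element [n] of the set forces [1 <= k], so [k] itself belongs to it and the coefficients
     outside vanish; for [k = 0] the set is empty. *)
  have /negPf jk' : j != k.
    apply: contraNneq jk => ->; rewrite add1n ltnS leqnn andbT.
    by apply: leq_trans n1 _; rewrite -ltnS -add1n.
  by rewrite (ee' j) jk' rnorm0 mulr0 rnorm_ge0.
have sE : sigma_hat e e' k (e k) = (rnorm (e k))%:E.
  have S0 n : (n <= k)%N -> partial_sum e e' n (e k) = 0.
    move=> nk; rewrite /partial_sum big1 // => i _.
    by rewrite ee' ltn_eqF ?scale0r // (leq_trans (ltn_ord i)).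
  apply/eqP; rewrite eq_le; apply/andP; split.
    by apply: ereal_inf_lbound; exists 0%N => //; rewrite S0 // subr0.
  by apply: le_ereal_inf_tmp => _ [n /= nk <-]; rewrite S0 // subr0.
have := le_trans (gamma_ge gL) gC.
rewrite sE -EFinM lee_fin => /(le_trans (rnorm_ge0 _)).
by rewrite pmulr_lge0.
Qed.

End Sums.

Theorem proposition1p3 (R : realType) (F : scalar_kind)
    (X : completeNormedModType (scalars R F))
    (e : nat -> X) (e' : nat -> {linear X -> (scalars R F)^o})
    (tau : R) (m : nat) :
  infinite_dimensional X -> Mbasis e e' -> 0 < tau -> tau <= 1 ->
  (nu_left e e' m tau / tau%:E
     <= \big[maxe/-oo]_(k < m.+1) Lre_hat e e' k tau)%E.
Proof.
move=> _ /Mbasis_biorthogonal[_ ee'] tau0 tau1.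
rewrite inver gt_eqF // lee_pdivrMr //; apply: ge_ereal_sup => r.
move=> [eps [delta [x [A [B [[heps hdelta hx]]]]]]].
move=> [[BA Am Ax BxA Bm] [den0 ->]].
have [n [k [y [L [nk km gL yL yn]]]]] :=
  exists_Lre_vector e e' ee' tau0 tau1 heps hdelta hx BA Am Ax BxA Bm.
rewrite -lee_pdivrMr //.
apply: (@Order.TotalTheory.bigmax_sup _ _ _ _ (Ordinal (km : (k < m.+1)%N))) => //=.
apply: le_ereal_inf_tmp => _ [C hC <-].
(* The sign of [C] lets the bound on [sigma_hat] be multiplied by [C] below. *)
have C0 : 0 <= C := Lre_constant_ge0 e e' ee' k tau C hC.
have den_gt0 : 0 < rnorm (x + signed_sum e eps A).
  by rewrite lt_neqAle eq_sym den0 rnorm_ge0.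
rewrite -EFinM lee_fin !ler_pdivrMr // -mulrA -lee_fin -yL EFinM.
(* It remains to bound [sigma_hat] at [y] by [tau] times the denominator; since [n <= k], the
   partial sum [S_n y] competes in that infimum. *)
apply: le_trans (gamma_ge e e' gL) (le_trans (hC y) _).
apply: lee_wpmul2l; first by rewrite lee_fin.
rewrite -rnormZ ?(ltW tau0) // -yn.
by apply: ereal_inf_lbound; exists n.
Qed.
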